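(* Let $e \geq 5$ be an integer and let $G$ be a finite $2$-group of maximal class of order $2^{e+1}$. Then the minimum genus $\mu(G)$ and the stable upper genus $\sigma(G)$ are as follows. (1) If $G$ is dihedral, then $\mu(G) = 2^{e-1}$ and $\sigma(G) = (e-3)2^e + 4$. (2) If $G$ is quaternion, then $\mu(G) = 2^{e-1}$ and $\sigma(G) = (e-3)2^e + 2^{e-1} + 3$. (3) If $G$ is semi-dihedral, then $\mu(G) = 2^{e-2}$ and $\sigma(G) = (e-3)2^e + 2^{e-2} + 3$.
   Context: For a finite group $G$, the genus spectrum $\mathrm{sp}(G)$ is the set of all integers $g \geq 2$ such that there exist integers $h \geq 0$, $r \geq 0$, $n_1,\dots,n_r \geq 2$ with $$2(g-1) = |G|\Big(2(h-1) + \sum_{i=1}^r \big(1 - \tfrac{1}{n_i}\big)\Big),$$ and elements $a_1,b_1,\dots,a_h,b_h,c_1,\dots,c_r \in G$ which generate $G$, satisfy $\prod_{i=1}^h [a_i,b_i] \cdot \prod_{j=1}^r c_j = 1$, and are such that $c_j$ has order $n_j$ for $1 \le j \le r$. (Equivalently, $G$ acts faithfully and orientation-preservingly on a closed compact orientable surface of genus $g$.) The genus increment $N_G$ is the positive integer such that every $g \in \mathrm{sp}(G)$ satisfies $g \equiv 1 \pmod{N_G}$ and all but finitely many positive integers $g \equiv 1 \pmod {N_G}$ lie in $\mathrm{sp}(G)$ (it exists by a theorem of Kulkarni). The minimum genus is $\mu(G) = \min \mathrm{sp}(G)$, and the stable upper genus is $\sigma(G) = \min\{ g \in \mathrm{sp}(G)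 : g + N_G k \in \mathrm{sp}(G) \text{ for all integers } k \ge 0\}$. The $2$-groups of maximal class of order $2^{e+1}$ fall into exactly three isomorphism types: dihedral $\langle y,x : x^2 = 1 = y^{2^e},\ x^{-1}yx = y^{-1}\rangle$; quaternion $\langle y,x : x^2 = y^{2^{e-1}},\ x^4 = 1,\ x^{-1}yx = y^{-1}\rangle$; semi-dihedral $\langle y,x : x^2 = 1 = y^{2^e},\ x^{-1}yx = y^{2^{e-1}-1}\rangle$. *)

(* Defs.v *)
From mathcomp Require Import all_boot all_order all_algebra.
From mathcomp Require Import all_fingroup all_solvable.

Set Implicit Arguments.
Unset Strict Implicit.
Unset Printing Implicit Defensive.

Import GRing.Theory Num.Theory.
Local Open Scope group_scope.

(* The Riemann-Hurwitz equation is stated in rat, since h - 1 and g - 1 must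
   not be truncated subtractions. The generation condition already forces all
   a i, b i and c j to lie in G. *)
Definition genus_spectrum (gT : finGroupType) (G : {group gT}) (g : nat) : Prop :=
  (2 <= g)%N /\
  exists (h r : nat) (n : 'I_r -> nat)
         (a b : 'I_h -> gT) (c : 'I_r -> gT),
    [/\ forall j, (2 <= n j)%N,
        (2 * (g%:R - 1) =
           #|G|%:R * (2 * (h%:R - 1) + \sum_(j < r) (1 - 1 / (n j)%:R)) :> rat)%R,
        << [set a i | i : 'I_h] :|: [set b i | i : 'I_h]
             :|: [set c j | j : 'I_r] >> = G,
        (\prod_(i < h) [~ a i, b i]) * (\prod_(j < r) c j) = 1
      & forall j, #[c j] = n j].

(* The list s contains the finitely many exceptions. *)
Definition is_genus_increment (gT : finGroupType) (G : {group gT}) (N : nat) : Prop :=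
  [/\ (0 < N)%N,
      forall g, genus_spectrum G g -> g = 1 %[mod N]
    & exists s : seq nat,
        forall g, (0 < g)%N -> g = 1 %[mod N] -> g \notin s -> genus_spectrum G g].

Definition is_minimum (P : nat -> Prop) (m : nat) : Prop :=
  P m /\ forall k, P k -> (m <= k)%N.

Definition is_minimum_genus (gT : finGroupType) (G : {group gT}) (m : nat) : Prop :=
  is_minimum (genus_spectrum G) m.

(* A genus increment is unique when it exists, so the existential
   quantification over N only names it. *)
Definition is_stable_upper_genus (gT : finGroupType) (G : {group gT}) (m : nat) : Prop :=
  exists2 N, is_genus_increment G N &
    is_minimum
      (fun g => genus_spectrum G g /\ forall k, genus_spectrum G (g + N * k)%N) m.

(* Order p ^ n and nilpotency class n - 1. *)
Definition maximal_class (p : nat) (gT : finGroupType) (G : {group gT}) : Prop :=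
  p.-group G /\ nil_class G = (logn p #|G|).-1.

(* Below the order of the group is 2 ^ e.+1, and y ^ x is x^-1 * y * x. *)
Definition is_dihedral (e : nat) (gT : finGroupType) (G : {group gT}) : Prop :=
  G \isog Grp (y : x : x ^+ 2, y ^+ (2 ^ e), y ^ x = y^-1).

Definition is_quaternion (e : nat) (gT : finGroupType) (G : {group gT}) : Prop :=
  G \isog Grp (y : x : x ^+ 2 = y ^+ (2 ^ e.-1), x ^+ 4, y ^ x = y^-1).

Definition is_semidihedral (e : nat) (gT : finGroupType) (G : {group gT}) : Prop :=
  G \isog Grp (y : x : x ^+ 2, y ^+ (2 ^ e), y ^ x = y ^+ (2 ^ e.-1).-1).

(* Main.v *)
Require Import Defs.
From mathcomp Require Import all_boot all_order all_algebra.
From mathcomp Require Import all_fingroup all_solvable.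
From mathcomp Require Import zify ring lra.

(** Let [G] be one of the groups, with rotation [y] of order [2 ^ e]. Its maximal
    subgroups are [<[y]>], a subgroup [M] and a subgroup [N]; they have index 2 and
    meet pairwise in the Frattini subgroup, generated by [y ^+ 2]. An element of
    [<[y]>] outside the Frattini subgroup has order [2 ^ e], and one outside
    [<[y]>] has order [2 ^ k] or [2 ^ l] according as it lies in [M] or [N], where
    [(k, l)] is [(1, 1)], [(2, 2)] or [(1, 2)] in the dihedral, quaternion and
    semidihedral case.

    Cleared of denominators, the Riemann-Hurwitz equation reads
    [g + 2 ^ e.+1 + T = 1 + (2 * h + r) * 2 ^ e], where [T] is the sum of the
    numbers [2 ^ e %/ n_j], all of them powers of two below [2 ^ e]. Which sums [T]
    with [r] terms can arise? Elements of the Frattini subgroup may be added at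
    will. On a sphere, the numbers [alpha], [beta], [gamma] of branch elements in
    the three nontrivial cosets of the Frattini subgroup must have the same parity
    (the product is 1) and at most one of them vanishes (the elements generate);
    this is [genus_signature]. Conversely, any such numbers are realized, because
    one branch element outside [<[y]>] can absorb the product of all the others
    without a change of its order ([genus_sphere]).

    What remains is arithmetic. Write [g + 2 ^ e.+1 + s = 1 + q * 2 ^ e] with
    [s < 2 ^ e]. The least number of powers of two below [2 ^ e] with sum [s] is
    its number of binary digits 1, and pairs of central involutions fill up any
    larger number of branch points. Beyond the bounds of the theorem [q] is so
    large, compared with the digits of [s], that the cosets which the sphere
    requires can be included ([dihedral_stable], [quaternion_stable],
    [semidihedral_stable]), except that for quaternion groups and [s] congruent to
    2 modulo 4 a torus without such branch points serves instead ([genus_torus]).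
    Hence the genus increment is 1. The number just below each bound has [q = e],
    and its residue [s] has [e - 1] digits 1. As the least number of summands is
    subadditive ([weightD]), there is then no room for a handle
    and only two possible values for [T] ([tight_decomposition]); in both of them
    the required cosets would use up too many summands ([dihedral_gap],
    [odd_gap]). The minimum genus is attained on a sphere with one branch point in
    each coset, to which a central involution is added in the dihedral case, where
    three branch points give genus 0 ([genus_triangle], [genus_lower_bound]). *)

Set Implicit Arguments.
Unset Strict Implicit.
Unset Printing Implicit Defensive.

Import GRing.Theory Num.Theory.

(** * Sums of powers of two *)

(** The least number of powers [2 ^ i] with [i < e] whose sum is [s]: binary
    digits below [2 ^ e] cost 1 each, and each copy of [2 ^ e] in the quotient
    costs two copies of [2 ^ e.-1]. (For [e = 0] no such sum exists, and the
    value only serves the recursion.) *)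
Fixpoint weight (e s : nat) : nat :=
  if e is e'.+1 then odd s + weight e' s./2 else s.*2.

Lemma weight0 e : weight e 0 = 0.
Proof. by elim: e => //= e ->. Qed.

(** Subadditivity is what makes [weight] a lower bound for every expression of
    a number as a sum of small powers of two: a carry merges two summands into
    one, and the carry into [2 ^ e] still leaves a total of 2. *)
Lemma weightD e a b : weight e (a + b) <= weight e a + weight e b.
Proof.
elim: e a b => [|e IHe] a b /=; first by rewrite doubleD.
rewrite oddD halfD; case: (odd a); case: (odd b) => /=; rewrite ?add0n ?add1n.
- apply: leq_trans (IHe 1 _) _.
  have : weight e 1 <= 2 by case: (e) => //= e'; rewrite weight0.
  by have := IHe a./2 b./2; lia.
- by have := IHe a./2 b./2; lia.
- by have := IHe a./2 b./2; lia.
- exact: IHe.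
Qed.

Lemma weight_double e s : weight e.+1 s.*2 = weight e s.
Proof. by rewrite /= odd_double doubleK. Qed.

Lemma weight_split e j a b :
  b < 2 ^ j -> weight (j + e) (a * 2 ^ j + b) = weight j b + weight e a.
Proof.
elim: j b => [|j IHj] b; first by case: b => // _; rewrite muln1 addn0.
rewrite expnS => lt_b /=; have ->: a * (2 * 2 ^ j) = (a * 2 ^ j).*2 by lia.
rewrite oddD odd_double halfD odd_double /= doubleK add0n IHj ?addnA //.
by lia.
Qed.

Lemma weight_exp e i : i < e -> weight e (2 ^ i) = 1.
Proof.
move=> lt_ie; have:= @weight_split (e - i) i 1 0 (expn_gt0 _ _).
rewrite mul1n addn0 subnKC 1?ltnW // => ->; rewrite weight0.
by case: (e - i) (subn_gt0 i e) => [|d] /=; rewrite ?lt_ie ?weight0.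
Qed.

Lemma weight_muln e m b : weight e (m * b) <= m * weight e b.
Proof.
elim: m => [|m IHm]; first by rewrite weight0.
by rewrite !mulSn (leq_trans (weightD _ _ _)) ?leq_add2l.
Qed.

Lemma weight_ones j : weight j (2 ^ j).-1 = j.
Proof.
elim: j => //= j IHj; have P_gt0 := expn_gt0 2 j.
rewrite -[RHS]add1n; have ->: (2 ^ j.+1).-1./2 = (2 ^ j).-1 by rewrite expnS; lia.
have ->: odd (2 ^ j.+1).-1 by rewrite expnS; lia.
by rewrite IHj.
Qed.

(** No summand exceeds [2 ^ e.-1]. *)
Lemma leq_weight_exp e s : s <= weight e s * 2 ^ e.-1.
Proof.
elim: e s => [|e IHe] s /=; first by lia.
case: e IHe => [|e] IHe /=; first by lia.
have := IHe s./2 => /=; rewrite expnS; have := expn_gt0 2 e.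
move: (2 ^ e) (weight _ _) => P w; case: (boolP (odd s)) => os; nia.
Qed.

Lemma weight_small e j s : j <= e -> s < 2 ^ j -> weight e s = weight j s.
Proof.
move=> le_je lt_s; have := @weight_split (e - j) j 0 s lt_s.
by rewrite mul0n add0n subnKC // => ->; rewrite weight0 addn0.
Qed.

Lemma weight_leq e j s : j <= e -> s < 2 ^ j -> weight e s <= j.
Proof.
move=> le_je lt_s; rewrite (weight_small le_je) //.
elim: j s {e le_je} lt_s => [|j IHj] s /=; first by case: s.
by rewrite expnS => lt_s; have := IHj s./2; lia.
Qed.

(** Only [2 ^ j - 1] has all its [j] binary digits equal to 1. *)
Lemma weight_ltn e j s : j <= e -> s.+1 < 2 ^ j -> weight e s < j.
Proof.
move=> le_je lt_s; rewrite (weight_small le_je (ltnW lt_s)).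
elim: j s {e le_je} lt_s => [|j IHj] s /=; first by case: s.
rewrite expnS => lt_s; have := odd_double_half s.
case: (odd s) => /= def_s; first by rewrite add1n ltnS IHj; lia.
by rewrite add0n ltnS; apply: (@weight_leq j j); lia.
Qed.

Lemma weight_attained e s :
  exists l, [/\ all (fun i => i < e.+1) l, \sum_(i <- l) 2 ^ i = s
               & size l = weight e.+1 s].
Proof.
elim: e s => [|e IHe] s.
  exists (nseq s 0); split; last by rewrite size_nseq /=; lia.
    by rewrite all_nseq orbT.
  by elim: s => [|s IHs] /=; rewrite ?big_nil ?big_cons ?IHs.
have [l [ltl suml sizel]] := IHe s./2.
exists (nseq (odd s) 0 ++ map succn l); split.
- by rewrite all_cat all_nseq orbT all_map.
- rewrite big_cat big_map /=.
  rewrite (eq_bigr _ (fun i _ => expnS 2 i)) -big_distrr /= suml.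
  by case: (boolP (odd s)) => os; rewrite /= ?big_cons big_nil; lia.
- by rewrite size_cat size_nseq size_map sizel.
Qed.

(** Adding a pair of copies of [2 ^ e.-1] to a sum of powers below [2 ^ e] adds
    [2 ^ e] to it. For branch elements this adds a pair of central
    involutions, which is how room for further branch points is filled. *)
Lemma weight_padding (e S n d : nat) : (0 < e) -> (n = weight e S + d.*2) ->
  exists l, [/\ all (fun i => i < e) l, (\sum_(i <- l) 2 ^ i = S + d * 2 ^ e)
               & size l = n].
Proof.
case: e => // e _ ->; have [l [lt_l suml sizel]] := weight_attained e S.
exists (l ++ nseq d.*2 e); split.
- by rewrite all_cat lt_l all_nseq ltnSn orbT.
- by rewrite big_cat big_nseq iter_addn_0 /= suml expnS; lia.
- by rewrite size_cat size_nseq sizel.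
Qed.

Local Open Scope group_scope.

(** * The genus spectrum of a 2-group *)

(** Once denominators are cleared and the subtractions moved across, a branch
    point of order [n] counts for [2 ^ e] on the right and for the power of two
    [2 ^ e %/ n] on the left; the genera that occur then depend on sums of such
    powers. *)
Lemma riemann_hurwitz_nat (e g h r : nat) (n : 'I_r -> nat) :
    (forall j, n j %| 2 ^ e) ->
  (2 * (g%:R - 1) = (2 ^ e.+1)%:R *
      (2 * (h%:R - 1) + \sum_(j < r) (1 - 1 / (n j)%:R)) :> rat)%R
  <-> (g + 2 ^ e.+1 + \sum_(j < r) 2 ^ e %/ n j
         = 1 + h * 2 ^ e.+1 + r * 2 ^ e)%N.
Proof.
move=> n_dvd.
have -> : (\sum_(j < r) (1 - 1 / (n j)%:R) =
             r%:R - (\sum_(j < r) 2 ^ e %/ n j)%:R / (2 ^ e)%:R :> rat)%R.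
  rewrite raddf_sum /= mulr_suml -sumrN.
  rewrite (eq_bigr (fun j => 1 - (2 ^ e %/ n j)%:R / (2 ^ e)%:R))%R.
    by rewrite big_split /= sumr_const card_ord sumrN.
  move=> j _; congr (_ - _)%R; case/dvdnP: (n_dvd j) => d def2e.
  have : (0 < 2 ^ e)%N by rewrite expn_gt0.
  rewrite {}def2e muln_gt0 => /andP[d_gt0 n_gt0]; rewrite mulnK // natrM.
  by field; rewrite !pnatr_eq0 -!lt0n d_gt0 n_gt0.
set W := (\sum_(j < r) _)%N; rewrite expnS; have: (0 < 2 ^ e)%N by rewrite expn_gt0.
move: (2 ^ e)%N => P P_gt0; have Pn0 : (P%:R != 0 :> rat)%R by rewrite pnatr_eq0 -lt0n.
have -> : ((2 * P)%:R * (2 * (h%:R - 1) + (r%:R - W%:R / P%:R)) =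
   2 * (2 * P%:R * (h%:R - 1) + r%:R * P%:R - W%:R) :> rat)%R.
  by rewrite natrM; field.
have -> : (g + 2 * P + W = 1 + h * (2 * P) + r * P)%N <->
  (g%:R + 2 * P%:R + W%:R = 1 + h%:R * (2 * P%:R) + r%:R * P%:R :> rat)%R.
  rewrite -[1%R]/(1%:R)%R -!(natrM, natrD).
  by split=> [-> // | /eqP]; rewrite eqr_nat => /eqP.
by split=> eq_g; lra.
Qed.

(** A sequence of branch elements is easier to build and to sort by cosets than
    a family indexed by ordinals; the orders need not be recorded apart. *)
Lemma genus_spectrum_seq (gT : finGroupType) (G : {group gT}) (e g : nat) :
    #|G| = (2 ^ e.+1)%N -> {in G, forall z, #[z] %| 2 ^ e} ->
  genus_spectrum G g <->
  (2 <= g)%N /\ exists (h : nat) (a b : 'I_h -> gT) (c : seq gT),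
    [/\ {in c, forall z, 2 <= #[z]}%N,
        (g + 2 ^ e.+1 + \sum_(z <- c) 2 ^ e %/ #[z]
           = 1 + h * 2 ^ e.+1 + size c * 2 ^ e)%N,
        << [set a i | i : 'I_h] :|: [set b i | i : 'I_h] :|: [set z in c] >> = G
      & (\prod_(i < h) [~ a i, b i]) * \prod_(z <- c) z = 1].
Proof.
move=> oG expG; split=> -[g_ge2].
  case=> h [r [n [a [b [c [n_ge2 RH genG prod1 ordc]]]]]]; split=> //.
  exists h, a, b, [seq c j | j <- index_enum 'I_r]; split.
  - by move=> _ /mapP[j _ ->]; rewrite ordc.
  - have -> : size [seq c j | j <- index_enum 'I_r] = r.
      by rewrite size_map [index_enum _]unlock -enumT size_enum_ord.
    have := (@riemann_hurwitz_nat e g h r n _).1; rewrite -oG => <- //.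
      by rewrite big_map; congr (_ + _)%N; apply: eq_bigr => j _; rewrite ordc.
    move=> j; rewrite -ordc expG // -genG mem_gen //.
    by rewrite !inE [X in _ || X]imset_f ?orbT.
  - rewrite -[RHS]genG; congr << _ :|: _ >>; apply/setP=> z; rewrite inE.
    apply/mapP/imsetP=> -[j _ ->]; exists j => //.
    exact: mem_index_enum.
  - by rewrite big_map.
case=> h [a [b [c [c_ge2 RH genG prod1]]]]; split=> //.
exists h, (size c), (fun j => #[tnth (in_tuple c) j]), a, b, (tnth (in_tuple c)).
have c_tnth j : tnth (in_tuple c) j \in c by exact: mem_tnth.
split=> //.
- by move=> j; apply: c_ge2.
- rewrite oG; apply/riemann_hurwitz_nat.
    move=> j; rewrite expG // -genG mem_gen // !inE c_tnth ?orbT //.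
  by rewrite -RH [in RHS]big_tnth.
- rewrite -[RHS]genG; congr << _ :|: _ >>; apply/setP=> z; rewrite inE.
  apply/imsetP/idP=> [[j _ ->] // | /(tnthP (in_tuple c))[j ->]].
  by exists j.
- by rewrite -[RHS]prod1 [in RHS](big_tnth _ _ c).
Qed.

(** * The three maximal subgroups *)

Lemma index2_memM (gT : finGroupType) (G M : {group gT}) :
    M \subset G -> #|G : M| = 2 ->
  {in G &, forall u v, (u * v \in M) = ((u \in M) == (v \in M))}.
Proof.
move=> sMG iMG u v Gu Gv; case Mu: (u \in M); first by rewrite groupMl.
case Mv: (v \in M); first by rewrite groupMr ?Mu.
have: v^-1 \in M :* u by rewrite (rcoset_index2 sMG iMG) !inE ?groupV ?Mv ?Mu.
by rewrite mem_rcoset -invMg groupV.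
Qed.

Lemma index2_mem_prod (gT : finGroupType) (G M : {group gT}) (c : seq gT) :
    M \subset G -> #|G : M| = 2 -> {subset c <= G} ->
  (\prod_(z <- c) z \in M) = ~~ odd (count (fun z => z \notin M) c).
Proof.
move=> sMG iMG; elim: c => [|z c IHc] sub_c; first by rewrite big_nil group1.
have sub'_c : {subset c <= G} by move=> t ct; rewrite sub_c // inE ct orbT.
have Gz : z \in G by rewrite sub_c ?mem_head.
have Gc : \prod_(t <- c) t \in G by rewrite big_seq; apply: group_prod.
rewrite big_cons (index2_memM sMG iMG) // IHc //= oddD.
by case: (z \in M); case: (odd _).
Qed.

(** What the dihedral, quaternion and semidihedral groups have in common: a
    rotation [y] that generates a maximal subgroup, and two other maximal
    subgroups [M] and [N] that contain the conjugacy classes of [x] and [y * x],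
    which make up the complement of [<[y]>]. The types of groups are told apart
    by the orders [2 ^ k] and [2 ^ l] of the elements of these classes. *)
Record rotation_frame (gT : finGroupType) (G : {group gT}) (e k l : nat)
    (y x : gT) (M N : {group gT}) : Prop := RotationFrame {
  frame_card : #|G| = (2 ^ e.+1)%N;
  frame_exps : [/\ 0 < k <= e & 0 < l <= e]%N;
  frame_y : y \in G;
  frame_oy : #[y] = (2 ^ e)%N;
  frame_x : x \in M :\: <[y]>;
  frame_yx : y * x \in N;
  frame_maximal : forall H : {group gT},
    maximal H G = pred3 <[y]> (M : {set gT}) (N : {set gT}) H;
  frame_classes : x ^: G :|: (y * x) ^: G = G :\: <[y]>;
  frame_ox : #[x] = (2 ^ k)%N;
  frame_oyx : #[y * x] = (2 ^ l)%N }.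

Section Frame.

Variables (gT : finGroupType) (G : {group gT}) (e k l : nat) (y x : gT).
Variables (M N : {group gT}).
Hypothesis frameG : rotation_frame G e k l y x M N.

Let X := <[y]>.

Lemma frame_index2 (H : {group gT}) :
  pred3 X (M : {set gT}) (N : {set gT}) H -> H \subset G /\ #|G : H| = 2.
Proof.
rewrite -(frame_maximal frameG) => maxH.
have pG : 2.-group G by rewrite /pgroup (frame_card frameG) pnatX.
by split; [case/andP: (maxgroupp maxH) | apply: p_maximal_index].
Qed.

Lemma frame_sub_index2 :
  [/\ X \subset G /\ #|G : X| = 2, M \subset G /\ #|G : M| = 2
    & N \subset G /\ #|G : N| = 2].
Proof. by split; apply: frame_index2; rewrite /= eqxx ?orbT. Qed.

Lemma frame_memM (H : {group gT}) :
    pred3 X (M : {set gT}) (N : {set gT}) H ->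
  {in G &, forall u v, (u * v \in H) = ((u \in H) == (v \in H))}.
Proof. by case/frame_index2; apply: index2_memM. Qed.

Lemma frame_gens : [/\ x \in G, y \notin M, y \notin N & x \notin N].
Proof.
have [[_ iX] [sMG iM] [sNG iN]] := frame_sub_index2.
have [/setDP[Mx X'x] Nyx] := (frame_x frameG, frame_yx frameG).
have Gx := subsetP sMG x Mx.
have noty (H : {group gT}) : #|G : H| = 2 -> H \subset G -> x \in H -> y \notin H.
  move=> iH sHG Hx; apply: contra X'x => Hy.
  suff eqXH : X = H by rewrite -/X eqXH.
  apply/eqP; rewrite eqEcard cycle_subG Hy /=.
  have sXG : X \subset G by rewrite cycle_subG frameG.(frame_y).
  by rewrite -(leq_pmul2r (isT : 0 < 2)%N) -{1}iH -iX !Lagrange.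
have N'y : y \notin N.
  apply/negP=> Ny; have Nx : x \in N by rewrite -(groupMl _ Ny).
  by have := noty N iN sNG Nx; rewrite Ny.
split=> //; first exact: noty.
by apply: contra N'y => Nx; rewrite -(groupMr _ Nx).
Qed.

Lemma frame_mem_exp (H : {group gT}) i :
    pred3 X (M : {set gT}) (N : {set gT}) H -> y \notin H ->
  (y ^+ i \in H) = ~~ odd i.
Proof.
move=> isH H'y; have Gy := frameG.(frame_y).
elim: i => [|i IHi]; first by rewrite expg0 group1.
by rewrite expgS (frame_memM isH) ?(groupX i Gy) // IHi (negPf H'y) /=; case: odd.
Qed.

(** In the Klein four quotient, whose three subgroups of order 2 are the images
    of the maximal subgroups, an element is the identity or lies in just one. *)
Lemma frame_memN z : z \in G -> (z \in N) = ((z \in X) == (z \in M)).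
Proof.
move=> Gz; have [Gx M'y N'y N'x] := frame_gens; have Gy := frameG.(frame_y).
have /setDP[Mx X'x] := frame_x frameG.
have isX : pred3 X (M : {set gT}) (N : {set gT}) [group of X] by rewrite /= eqxx.
have isM : pred3 X (M : {set gT}) (N : {set gT}) M by rewrite /= eqxx orbT.
have isN : pred3 X (M : {set gT}) (N : {set gT}) N by rewrite /= eqxx !orbT.
have powN i : (y ^+ i \in N) = (y ^+ i \in M).
  by rewrite !frame_mem_exp.
case Xz: (z \in X).
  by case/cycleP: Xz => i ->; rewrite powN; case: (_ \in _).
have /cycleP[i def_zx] : z * x^-1 \in X.
  by rewrite (frame_memM isX) ?groupV //= Xz (negPf X'x).
have -> : z = y ^+ i * x by rewrite -def_zx mulgKV.
rewrite (frame_memM isN) ?(groupX i Gy) // (frame_memM isM) ?(groupX i Gy) //.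
by rewrite powN Mx (negPf N'x); case: (_ \in _).
Qed.

Lemma frame_mem_class (H : {group gT}) t z :
    pred3 X (M : {set gT}) (N : {set gT}) H -> t \in H -> z \in t ^: G -> z \in H.
Proof.
move=> isH Ht /imsetP[w Gw ->]; have [sHG iH] := frame_index2 isH.
by rewrite memJ_norm // (subsetP (normal_norm (index2_normal sHG iH))).
Qed.

Lemma frame_oM : {in M :\: X, forall z, #[z] = (2 ^ k)%N}.
Proof.
move=> z /setDP[Mz X'z]; have [_ [sMG _] _] := frame_sub_index2.
have Gz := subsetP sMG z Mz; have : z \in G :\: X by rewrite inE X'z.
rewrite -frameG.(frame_classes) => /setUP[/imsetP[w _ ->] | cl_z].
  by rewrite orderJ frameG.(frame_ox).
have : z \in N.
  by apply: frame_mem_class cl_z; rewrite ?frameG.(frame_yx) //= eqxx !orbT.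
by rewrite frame_memN // (negPf X'z) Mz.
Qed.

Lemma frame_oN : {in N :\: X, forall z, #[z] = (2 ^ l)%N}.
Proof.
move=> z /setDP[Nz X'z]; have [_ _ [sNG _]] := frame_sub_index2.
have Gz := subsetP sNG z Nz; have : z \in G :\: X by rewrite inE X'z.
rewrite -frameG.(frame_classes) => /setUP[cl_z | /imsetP[w _ ->]].
  have /setDP[Mx _] := frameG.(frame_x).
  have Mz : z \in M by apply: frame_mem_class cl_z; rewrite //= eqxx !orbT.
  by move: Nz; rewrite frame_memN // (negPf X'z) Mz.
by rewrite orderJ frameG.(frame_oyx).
Qed.

Lemma frame_order_rotation z : z \in X -> z \notin M -> #[z] = (2 ^ e)%N.
Proof.
have [_ M'y _ _] := frame_gens; case/cycleP=> i ->.
rewrite frame_mem_exp //= ?eqxx ?orbT // negbK => odd_i.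
rewrite orderXgcd frameG.(frame_oy).
suff /eqP-> : coprime (2 ^ e) i by rewrite divn1.
by rewrite coprimeXl // coprime2n.
Qed.

(** Such a [z] is a power of [y ^+ 2], so that its order is a proper divisor of
    [2 ^ e] and the quotient is even. *)
Lemma frame_order_Frattini z :
    z \in X -> z \in M -> (1 < #[z])%N ->
  exists2 i, (i < e.-1)%N & (2 ^ e %/ #[z] = 2 * 2 ^ i)%N.
Proof.
have [_ M'y _ _] := frame_gens; case/cycleP=> i ->.
rewrite frame_mem_exp //= ?eqxx ?orbT //; have oy := frameG.(frame_oy).
have [/andP[k_gt0 le_ke] _] := frameG.(frame_exps) => even_i o_gt1.
have : #[y ^+ i] %| 2 ^ e.-1.
  rewrite order_dvdn -expgM -order_dvdn oy -{1}(ltn_predK (leq_trans k_gt0 le_ke)).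
  by rewrite expnS dvdn_mul // dvdn2.
case/(dvdn_pfactor _ _ (isT : prime 2)) => m le_me def_o.
exists (e.-1 - m)%N; first by case: m le_me def_o o_gt1 => [|m]; [move=> _ -> | lia].
rewrite def_o -expnS -expnB //; last by lia.
by congr (_ ^ _)%N; lia.
Qed.

Lemma frame_order_dvd z : z \in G -> #[z] %| 2 ^ e.
Proof.
move=> Gz; have [/andP[_ le_ke] /andP[_ le_le]] := frameG.(frame_exps).
case Xz: (z \in X); first by rewrite -frameG.(frame_oy); apply: order_dvdG.
have := frame_memN Gz; rewrite Xz; case Mz: (z \in M) => /= Nz.
  by rewrite frame_oM ?dvdn_exp2l // inE Mz Xz.
by rewrite frame_oN ?dvdn_exp2l // inE Nz Xz.
Qed.

(** A proper subgroup lies in one of the three maximal subgroups. *)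
Lemma frame_generate (A : {set gT}) :
    A \subset G -> ~~ (A \subset X) -> ~~ (A \subset M) -> ~~ (A \subset N) ->
  <<A>> = G.
Proof.
move=> sAG X'A M'A N'A.
have sgenG : <<A>> \subset G by rewrite gen_subG.
have [// | [H maxH]] := maximal_exists sgenG.
move: maxH; rewrite frameG.(frame_maximal) gen_subG.
by case/or3P=> /eqP->; rewrite ?(negPf X'A) ?(negPf M'A) ?(negPf N'A).
Qed.

(** Sorting branch elements by their image in the Klein four quotient: [alpha],
    [beta] and [gamma] count those in [<[y]>], [M] and [N] alone, and [n] those in
    the Frattini subgroup, whose contribution is even because their orders are
    proper divisors of [2 ^ e]. *)
Lemma frame_signature (c : seq gT) :
    {subset c <= G} -> {in c, forall z, 1 < #[z]}%N ->
  exists alpha beta gamma n S : nat,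
    [/\ count (fun z => z \notin X) c = (beta + gamma)%N,
        count (fun z => z \notin M) c = (alpha + gamma)%N
      & count (fun z => z \notin N) c = (alpha + beta)%N] /\
    [/\ (weight e.-1 S <= n)%N,
        size c = (alpha + beta + gamma + n)%N
      & (\sum_(z <- c) 2 ^ e %/ #[z]
           = alpha + beta * 2 ^ (e - k) + gamma * 2 ^ (e - l) + 2 * S)%N].
Proof.
have [/andP[k_gt0 le_ke] /andP[l_gt0 le_le]] := frameG.(frame_exps).
elim: c => [_ _|z c IHc sub_c c_gt1].
  by exists 0, 0, 0, 0, 0; rewrite big_nil weight0.
have [||a [b [g [n [S [[cX cM cN] [wS sz sm]]]]]]] := IHc.
- by move=> t ct; rewrite sub_c // inE ct orbT.
- by move=> t ct; rewrite c_gt1 // inE ct orbT.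
have Gz : z \in G by rewrite sub_c // mem_head.
have oz : (1 < #[z])%N by rewrite c_gt1 // mem_head.
have Nz := frame_memN Gz; rewrite /= big_cons cX cM cN sz sm Nz.
case Xz: (z \in X); case Mz: (z \in M) => /=.
- have [i lt_ie ->] := frame_order_Frattini Xz Mz oz.
  exists a, b, g, n.+1, (2 ^ i + S)%N; split; split; try by lia.
  by rewrite (leq_trans (weightD _ _ _)) // weight_exp.
- rewrite frame_order_rotation ?Xz ?Mz // divnn expn_gt0.
  by exists a.+1, b, g, n, S; split; split; lia.
- rewrite frame_oM ?inE ?Xz ?Mz // -expnB //.
  by exists a, b.+1, g, n, S; split; split; lia.
- rewrite frame_oN ?inE ?Xz ?Nz ?Xz ?Mz // -expnB //.
  by exists a, b, g.+1, n, S; split; split; lia.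
Qed.

End Frame.

(** * Generating vectors and their branch data *)

Section Spectrum.

Variables (gT : finGroupType) (G : {group gT}) (e k l : nat) (y x : gT).
Variables (M N : {group gT}).
Hypothesis frameG : rotation_frame G e k l y x M N.

Let X := <[y]>.

(** On a sphere the branch elements generate [G] and have product 1. Read modulo
    a subgroup of index 2, this says that the number of them outside of it is
    positive and even; the three maximal subgroups yield the conditions on the
    pairwise sums of [alpha], [beta] and [gamma]. *)
Lemma genus_signature g : genus_spectrum G g ->
  (2 <= g)%N /\ exists h alpha beta gamma n S : nat,
    [/\ (weight e.-1 S <= n)%N,
        (g + 2 ^ e.+1 + (alpha + beta * 2 ^ (e - k) + gamma * 2 ^ (e - l) + 2 * S)
           = 1 + h * 2 ^ e.+1 + (alpha + beta + gamma + n) * 2 ^ e)%N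
      & h = 0 -> [/\ odd alpha = odd gamma, odd beta = odd gamma
                   & [&& 0 < alpha + beta, 0 < alpha + gamma & 0 < beta + gamma]%N]].
Proof.
have oG := frame_card frameG.
case/(genus_spectrum_seq _ oG (frame_order_dvd frameG)) => g_ge2.
case=> h [a [b [c [c_gt1 RH genG prod1]]]]; split=> //.
have sub_c : {subset c <= G}.
  by move=> z cz; rewrite -genG mem_gen // !inE cz orbT.
have [al [be [ga [n [S [[cX cM cN] [wS sz sm]]]]]]] :=
  frame_signature frameG sub_c c_gt1.
exists h, al, be, ga, n, S; split=> //; first by rewrite -sm RH sz.
move=> h0; move: prod1 genG; rewrite {RH}h0 in a b *.
have noI (f : 'I_0 -> gT) : [set f i | i : 'I_0] = set0.
  by apply/setP=> z; rewrite inE; apply/imsetP=> -[[]].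
rewrite big_ord0 mul1g !noI !set0U => prod1 genG.
have count_out (H : {group gT}) : pred3 X (M : {set gT}) (N : {set gT}) H ->
    ~~ odd (count (fun z => z \notin H) c) /\ (0 < count (fun z => z \notin H) c)%N.
  move=> isH; have [sHG iH] := frame_index2 frameG isH.
  rewrite -(index2_mem_prod sHG iH sub_c) prod1 group1; split=> //.
  rewrite lt0n -leqn0 -ltnNge -has_count; apply/hasPn => cH.
  suff : G \subset H by rewrite -indexg_eq1 iH.
  rewrite -genG gen_subG; apply/subsetP=> z; rewrite inE => /cH.
  by rewrite negbK.
have [oX pX] := count_out [group of X] (introT or3P (Or31 _ _ (eqxx _))).
have [oM pM] := count_out M (introT or3P (Or32 _ _ (eqxx _))).
have [oN pN] := count_out N (introT or3P (Or33 _ _ (eqxx _))).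
move: oX pX oM pM oN pN; rewrite cX cM cN !oddD => oX -> oM -> oN ->.
by move: oX oM oN; do 3!case: odd.
Qed.

(** These conditions are sufficient: all branch elements can be chosen freely
    except one outside [<[y]>], which is solved from the relation. Parity forces
    the solution into [M :\: <[y]>], where every element has order [2 ^ k]. *)
Lemma genus_sphere_seq (alpha beta gamma g : nat) (s : seq nat) :
    (2 <= g)%N -> odd alpha = odd gamma -> odd beta.+1 = odd gamma ->
    (0 < alpha + gamma)%N -> all (fun i => i < e.-1)%N s ->
    (g + 2 ^ e.+1 + (alpha + beta.+1 * 2 ^ (e - k) + gamma * 2 ^ (e - l)
        + 2 * \sum_(i <- s) 2 ^ i)
       = 1 + (alpha + beta.+1 + gamma + size s) * 2 ^ e)%N ->
  genus_spectrum G g.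
Proof.
move=> g_ge2 odd_a odd_b ag_gt0 lt_s RH.
have [Gx M'y N'y N'x] := frame_gens frameG; have Gy := frame_y frameG.
have [/setDP[Mx X'x] Nyx] := (frame_x frameG, frame_yx frameG).
have isX : pred3 X (M : {set gT}) (N : {set gT}) [group of X] by rewrite /= eqxx.
have isM : pred3 X (M : {set gT}) (N : {set gT}) M by rewrite /= eqxx orbT.
have isN : pred3 X (M : {set gT}) (N : {set gT}) N by rewrite /= eqxx !orbT.
have [/andP[k_gt0 le_ke] /andP[l_gt0 le_le]] := frame_exps frameG.
have X'yx : y * x \notin X by rewrite groupMl // cycle_id.
have M'yx : y * x \notin M by rewrite groupMr.
set r := nseq alpha y ++ nseq beta x ++ nseq gamma (y * x)
           ++ [seq y ^+ (2 * 2 ^ i) | i <- s].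
(* The element that is solved from the relation. *)
pose z0 := (\prod_(z <- r) z)^-1.
have Gr : {subset r <= G}.
  move=> z; rewrite !mem_cat !mem_nseq.
  by case/or4P=> [/andP[_ /eqP->]|/andP[_ /eqP->]|/andP[_ /eqP->]|/mapP[i _ ->]];
    rewrite ?groupX ?groupM.
have countX : count (fun z => z \notin X) r = (beta + gamma)%N.
  rewrite !count_cat !count_nseq cycle_id X'x X'yx /= mul0n !mul1n.
  rewrite (_ : count _ [seq _ | _ <- s] = 0) ?addn0 //.
  by rewrite count_map; elim: (s) => //= i s' ->; rewrite mem_cycle.
have countM : count (fun z => z \notin M) r = (alpha + gamma)%N.
  rewrite !count_cat !count_nseq M'y Mx M'yx /= mul0n !mul1n.
  rewrite (_ : count _ [seq _ | _ <- s] = 0) ?addn0 //.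
  rewrite count_map; elim: (s) => //= i s' ->.
  by rewrite (frame_mem_exp frameG) // mul2n odd_double.
have Xz0 : z0 \notin X.
  have [sXG iX] := frame_index2 frameG isX.
  rewrite groupV (index2_mem_prod sXG iX Gr) countX negbK oddD.
  by rewrite -odd_b /=; case: odd.
have Mz0 : z0 \in M.
  have [sMG iM] := frame_index2 frameG isM.
  by rewrite groupV (index2_mem_prod sMG iM Gr) countM oddD odd_a addbb.
have Gz0 : z0 \in G by rewrite groupV big_seq; apply: group_prod.
have Nz0 : z0 \notin N by rewrite (frame_memN frameG) // (negPf Xz0) Mz0.
have oX i : (i < e.-1)%N -> #[y ^+ (2 * 2 ^ i)] = (2 ^ (e - i.+1))%N.
  by move=> lt_i; rewrite -expnS (orderXexp _ (frame_oy frameG)).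
have oz0 : #[z0] = (2 ^ k)%N by rewrite (frame_oM frameG) // inE Xz0 Mz0.
have ox : #[x] = (2 ^ k)%N by rewrite (frame_oM frameG) // inE X'x Mx.
have oyx : #[y * x] = (2 ^ l)%N by rewrite (frame_oN frameG) // inE X'yx Nyx.
apply/(genus_spectrum_seq _ (frame_card frameG) (frame_order_dvd frameG)).
split=> //; exists 0, (fun=> 1), (fun=> 1), (z0 :: r); split.
- move=> z; rewrite inE => /predU1P[-> | ].
    by rewrite oz0 (ltn_exp2l 0).
  rewrite !mem_cat !mem_nseq.
  case/or4P=> [/andP[_ /eqP->]|/andP[_ /eqP->]|/andP[_ /eqP->]|/mapP[i s_i ->]].
  + by rewrite (frame_oy frameG) (ltn_exp2l 0) // (leq_trans k_gt0).
  + by rewrite ox (ltn_exp2l 0).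
  + by rewrite oyx (ltn_exp2l 0).
  + have lt_i := allP lt_s i s_i.
    by rewrite oX // (ltn_exp2l 0) // subn_gt0 -ltn_predRL.
- rewrite mul0n addn0 big_cons !big_cat /= !big_nseq !iter_addn_0 oz0 ox oyx.
  rewrite (frame_oy frameG) divnn expn_gt0 -!expnB // big_map.
  rewrite (eq_big_seq (fun i => 2 * 2 ^ i))%N.
    rewrite -big_distrr !size_cat !size_nseq size_map /=.
    move: RH; move: (\sum_(i <- s) _)%N (size s) => S n.
    move: (2 ^ _)%N (2 ^ _)%N (2 ^ _)%N (2 ^ _)%N => P2 B C P RH.
    by clear -RH; lia.
  move=> i s_i; have lt_i := allP lt_s i s_i.
  by rewrite oX // -expnB ?leq_subr // subKn ?expnS // ltnW // -ltn_predRL.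
- set A := _ :|: _; have inA z : z \in z0 :: r -> z \in A.
    by move=> r_z; rewrite !inE -[_ || (_ \in r)]in_cons r_z orbT.
  have Az0 : z0 \in A by rewrite inA ?mem_head.
  apply: (frame_generate frameG).
  + apply/subsetP=> z; rewrite !inE => /orP[/orP[]/imsetP[[]] // |].
    by case/predU1P=> [-> // | /Gr].
  + by apply/subsetPn; exists z0.
  + have /hasP[z r_z M'z] : has (fun z => z \notin M) r.
      by rewrite has_count countM.
    by apply/subsetPn; exists z; rewrite // inA // inE r_z orbT.
  + by apply/subsetPn; exists z0.
- by rewrite big_ord0 mul1g big_cons mulVg.
Qed.

(** The summands [2 ^ e %/ #[z]] are to add up to [s] modulo [2 ^ e]. Each [2 ^ e]
    by which their sum exceeds [s] makes room for one branch point more than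
    [q], hence [q + c]; room left over is filled with pairs of central
    involutions. *)
Lemma genus_sphere (q s alpha beta gamma S c g : nat) :
    (1 < e)%N -> (2 <= g)%N -> (g + 2 ^ e.+1 + s = 1 + q * 2 ^ e)%N ->
    odd alpha = odd gamma -> odd beta = odd gamma ->
    (0 < beta)%N -> (0 < alpha + gamma)%N ->
    (alpha + beta * 2 ^ (e - k) + gamma * 2 ^ (e - l) + 2 * S = s + c * 2 ^ e)%N ->
    (alpha + beta + gamma + weight e.-1 S <= q + c)%N ->
  genus_spectrum G g.
Proof.
move=> e_gt1 g_ge2 RH odd_a odd_b; case: beta odd_b => // beta odd_b _ ag_gt0 defS le_n.
set w := weight e.-1 S in le_n; pose d := (q + c - (alpha + beta.+1 + gamma + w))%N.
have def_d : (alpha + beta.+1 + gamma + w + d = q + c)%N by rewrite subnKC.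
have e1_gt0 : (0 < e.-1)%N by rewrite ltn_predRL.
have [r [lt_r sum_r size_r]] := @weight_padding e.-1 S (w + d.*2) d e1_gt0 erefl.
apply: (genus_sphere_seq g_ge2 odd_a odd_b ag_gt0 lt_r).
have -> : (alpha + beta.+1 + gamma + size r = q + c + d)%N.
  by rewrite size_r -def_d -addnn !addnA.
have -> : (2 * \sum_(i <- r) 2 ^ i = 2 * S + d * 2 ^ e)%N.
  by rewrite sum_r mulnDr mulnCA -expnS prednK // (ltnW e_gt1).
rewrite [X in (_ + X)%N]addnA defS !mulnDl; move: RH.
by move: (2 ^ _)%N (2 ^ _)%N => P2 P RH; clear -RH; lia.
Qed.

(** On a torus no branch element has to lie outside the Frattini subgroup: [y]
    and [x] are a handle, and since [[~ y, x] = y ^- 2], the relation can be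
    solved by one element of order [2 ^ e.-1] when all others are powers of
    [y ^+ 4]. That element contributes the summand 2 and the others multiples of
    4, whence [2 + 4 * S]; the handle takes the place of two branch points. *)
Lemma genus_torus (q s S c g : nat) :
    (2 < e)%N -> (2 <= g)%N -> y ^ x = y^-1 ->
    (g + 2 ^ e.+1 + s = 1 + q * 2 ^ e)%N ->
    (2 + 4 * S = s + c * 2 ^ e)%N -> (3 + weight e.-2 S <= q + c)%N ->
  genus_spectrum G g.
Proof.
move=> e_gt2 g_ge2 conj_y.
have [Gx M'y N'y N'x] := frame_gens frameG; have Gy := frame_y frameG.
have X'x : x \notin X by case/setDP: (frame_x frameG).
have comm_yx : [~ y, x] = y ^- 2 by rewrite commgEl conj_y -invMg.
move: (frame_oy frameG) (frame_card frameG) (frame_order_dvd frameG).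
case: e e_gt2 => [|[|[|e']]] // _ oy oG expG RH defS le_n.
set w := weight e'.+1 S in le_n; pose d := (q + c - (3 + w))%N.
have def_d : (3 + w + d = q + c)%N by rewrite subnKC.
have [r [lt_r sum_r size_r]] := @weight_padding e'.+1 S (w + d.*2) d isT erefl.
have lt_re i : i \in r -> (i < e'.+1)%N := allP lt_r i.
pose zs := [seq y ^+ (4 * 2 ^ i) | i <- r].
have prod_zs : \prod_(z <- zs) z = y ^+ (4 * \sum_(i <- r) 2 ^ i).
  rewrite big_map big_distrr /=.
  exact/esym/(big_morph (fun n => y ^+ n) (expgD y) (expg0 y)).
pose z0 := ([~ y, x] * \prod_(z <- zs) z)^-1.
have oz0 : #[z0] = (2 ^ e'.+2)%N.
  pose j := (2 ^ e'.+2 - 1 + 2 * \sum_(i <- r) 2 ^ i)%N.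
  have -> : #[z0] = #[y ^+ 2 ^+ j].
    rewrite orderV comm_yx prod_zs -expgM mulnDr mulnA [in RHS]expgD.
    congr (#[_ * _]); apply/eqP; rewrite eq_invg_mul -expgD -mulnS.
    by rewrite subn1 prednK ?expn_gt0 // -expnS -oy expg_order.
  have oy2 : #[y ^+ 2] = (2 ^ e'.+2)%N by rewrite -[2%N]expn1 (orderXexp _ oy).
  rewrite orderXgcd oy2.
  suff /eqP-> : coprime (2 ^ e'.+2) j by rewrite divn1.
  rewrite coprimeXl // coprime2n /j oddD mul2n odd_double addbF.
  by rewrite oddB ?expn_gt0 // oddX.
have ozs i : (i < e'.+1)%N -> #[y ^+ (4 * 2 ^ i)] = (2 ^ (e'.+1 - i))%N.
  by move=> lt_i; rewrite -[4%N]/(2 ^ 2)%N -expnD (orderXexp _ oy) !subSS.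
apply/(genus_spectrum_seq _ oG expG).
split=> //; exists 1%N, (fun=> y), (fun=> x), (rcons zs z0); split.
- move=> z; rewrite mem_rcons inE => /predU1P[-> | /mapP[i /lt_re lt_i ->]].
    by rewrite oz0 (ltn_exp2l 0).
  by rewrite ozs // (ltn_exp2l 0) // subn_gt0.
- rewrite -cats1 big_cat big_seq1 size_cat size_map /= oz0 -expnB // subSnn big_map.
  rewrite (eq_big_seq (fun i => 4 * 2 ^ i))%N; last first.
    move=> i /lt_re lt_i; rewrite ozs // -expnB //; last first.
      by rewrite (leq_trans (leq_subr _ _)) // leqW.
    have -> : (e'.+3 - (e'.+1 - i) = 2 + i)%N by clear -lt_i; lia.
    by rewrite expnD.
  have -> : (\sum_(i <- r) 4 * 2 ^ i = 4 * S + d * 2 ^ e'.+3)%N.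
    by rewrite -big_distrr /= sum_r mulnDr mulnCA -[4%N]/(2 ^ 2)%N -expnD.
  have def_n : (2 + (size r + 1) = q + c + d)%N.
    by rewrite size_r -def_d -addnn; clear; lia.
  move: RH defS; rewrite expn1 mul1n [(2 ^ e'.+4)%N]expnS.
  move: (2 ^ _)%N => P RH defS.
  have -> : (1 + 2 * P + (size r + 1) * P = 1 + (2 + (size r + 1)) * P)%N.
    by clear; lia.
  by rewrite def_n !mulnDl; clear -RH defS; lia.
- set A := _ :|: _.
  have Ay : y \in A.
    by rewrite !inE; apply/orP; left; apply/orP; left; apply/imsetP; exists ord0.
  have Ax : x \in A.
    by rewrite !inE; apply/orP; left; apply/orP; right; apply/imsetP; exists ord0.
  have Gzs : {subset zs <= G} by move=> _ /mapP[i _ ->]; apply: groupX.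
  apply: (frame_generate frameG).
  + apply/subsetP=> z; rewrite !inE mem_rcons inE.
    case/orP=> [/orP[]/imsetP[_ _ ->] // | /predU1P[-> | /Gzs //]].
    by rewrite groupV groupM ?groupR // big_seq; apply: group_prod.
  + by apply/subsetPn; exists x.
  + by apply/subsetPn; exists y.
  + by apply/subsetPn; exists y.
- by rewrite big_ord1 -cats1 big_cat big_seq1 mulgA mulgV.
Qed.

End Spectrum.

(** * Dihedral, quaternion and semidihedral groups *)

Lemma homGrp_card_isog (gT rT : finGroupType) (G : {group gT}) (H : {group rT})
    (p : Presentation.term -> Presentation.type) :
  (H \isog Grp p) -> #|G| = #|H| -> (G \homg Grp p) -> G \isog H.
Proof.
by move=> isoH oG homG; rewrite isogEcard isoH homG oG leqnn.
Qed.

Section Frames.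

Variables (gT : finGroupType) (G : {group gT}) (e : nat).
Hypotheses (e_ge5 : (5 <= e)%N) (oG : #|G| = (2 ^ e.+1)%N).

Lemma extremal_frame (k l : nat) (y x : gT) :
    extremal_generators G 2 e.+1 (y, x) ->
    (forall H : {group gT},
       maximal H G = pred3 <[y]> <<x ^: G>> <<(y * x) ^: G>> (H : {set gT})) ->
    x ^: G :|: (y * x) ^: G = G :\: <[y]> ->
    #[x] = (2 ^ k)%N -> #[y * x] = (2 ^ l)%N -> (0 < k <= e)%N -> (0 < l <= e)%N ->
  rotation_frame G e k l y x <<x ^: G>>%G <<(y * x) ^: G>>%G.
Proof.
case=> _ Gy oy X'x maxG clG ox oyx k_e l_e.
split=> //; last by rewrite mem_gen ?class_refl.
by move: X'x; rewrite !inE => /andP[-> _]; rewrite mem_gen ?class_refl.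
Qed.

(** Each presentation agrees with the standard one up to the order or form of its
    relations, so [G] is a quotient of the standard group, and isomorphic to it
    by cardinality. *)
Lemma dihedral_frame : is_dihedral e G ->
  exists y x M N, rotation_frame G e 1 1 y x M N.
Proof.
move=> isoG; have n_gt1 : (1 < e.+1)%N by rewrite ltnS (leq_trans _ e_ge5).
have isoD : G \isog 'D_(2 ^ e.+1).
  apply: homGrp_card_isog (Grp_2dihedral n_gt1) _ _; first by rewrite card_2dihedral.
  have /existsP[[y x] /= /eqP[defG x2 yq yx]] := isoGrp_hom isoG.
  by apply/existsP; exists (y, x); rewrite /= defG x2 yq yx !eqxx.
have [[y x] genG _] := generators_2dihedral n_gt1 isoD.
have [[_ oX' _] _ _ [clG _ maxG] _] := dihedral2_structure n_gt1 genG isoD.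
case: (genG) => _ Gy _ X'x.
exists y, x, <<x ^: G>>%G, <<(y * x) ^: G>>%G; apply: extremal_frame => //.
- exact: oX'.
- by apply: oX'; rewrite -clG inE class_refl orbT.
Qed.

Lemma quaternion_frame : is_quaternion e G ->
  exists y x M N, rotation_frame G e 2 2 y x M N /\ y ^ x = y^-1.
Proof.
move=> isoG; have n_gt2 : (2 < e.+1)%N by rewrite ltnS (leq_trans _ e_ge5).
have isoQ : G \isog 'Q_(2 ^ e.+1).
  apply: homGrp_card_isog (Grp_quaternion n_gt2) _ _; first by rewrite card_quaternion.
  have /existsP[[y x] /= /eqP[defG x2 x4 yx]] := isoGrp_hom isoG.
  have yq : y ^+ (2 ^ e) = 1.
    rewrite -(ltn_predK e_ge5) expnSr expgM -x2 -expgM //.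
  by apply/existsP; exists (y, x); rewrite /= defG x2 yq yx !eqxx.
have [[y x] genG [_ _ yx]] := generators_quaternion n_gt2 isoQ.
have [[_ oX' _] _ _ [[clG _] maxG] _] := quaternion_structure n_gt2 genG isoQ.
exists y, x, <<x ^: G>>%G, <<(y * x) ^: G>>%G; split=> //.
case: (genG) => _ Gy _ X'x; apply: extremal_frame => //.
- exact: oX'.
- by apply: oX'; rewrite -clG inE class_refl orbT.
Qed.

Lemma semidihedral_frame : is_semidihedral e G ->
  exists y x M N, rotation_frame G e 1 2 y x M N.
Proof.
move=> isoG; have n_gt3 : (3 < e.+1)%N by rewrite ltnS (leq_trans _ e_ge5).
have isoS : G \isog 'SD_(2 ^ e.+1).
  apply: homGrp_card_isog (Grp_semidihedral n_gt3) _ _.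
    by rewrite card_semidihedral.
  have /existsP[[y x] /= /eqP[defG x2 yq yx]] := isoGrp_hom isoG.
  by apply/existsP; exists (y, x); rewrite /= defG x2 yq yx !eqxx.
have [[y x] genG [ox _]] := generators_semidihedral n_gt3 isoS.
have [[_ oyx _] _ _ [[clG _] maxG] _] := semidihedral_structure n_gt3 genG isoS ox.
exists y, x, <<x ^: G>>%G, <<(y * x) ^: G>>%G.
by apply: extremal_frame => //; lia.
Qed.

End Frames.

Local Close Scope group_scope.

(** * Genera that occur *)

(** The bound used on binary digits throughout: [s] has at most [j] of them, and
    at most [j - 1] in the critical case [q = e]. *)
Lemma weight_slack (d e j i q s : nat) :
  j <= d -> e <= q -> j + i = e.+1 -> s < 2 ^ j -> (q = e -> s.+1 < 2 ^ j) ->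
  weight d s + i <= q.
Proof.
move=> le_jd le_eq def_e lt_s; rewrite leq_eqVlt in le_eq.
case/predU1P: le_eq => [eq_eq /(_ (esym eq_eq)) | lt_eq _].
  by move/(weight_ltn le_jd); lia.
by have := weight_leq le_jd lt_s; lia.
Qed.

(** Here [g + 2 ^ e.+1 - 1] is rounded up to the multiple [q * 2 ^ e]. The bound on
    [g] enters in the critical case [q = e], which has the least room for branch
    points: it keeps [s] away from the residues of large weight. *)
Lemma genus_normal_form (e r g : nat) :
    0 < r -> 3 <= e -> (e - 3) * 2 ^ e + r < g ->
  exists q s, [/\ s < 2 ^ e, g + 2 ^ e.+1 + s = 1 + q * 2 ^ e, e <= q
                & q = e -> s + r <= 2 ^ e].
Proof.
move=> r_gt0 e_ge3 lt_g; rewrite expnS.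
have : 0 < 2 ^ e by rewrite expn_gt0.
move: (2 ^ e) lt_g => P lt_g P_gt0.
have lt_m : (e - 1) * P + r < g + 2 * P by nia.
move: (g + 2 * P) lt_m => m lt_m.
have := divn_eq (m + P - 2) P; have := ltn_pmod (m + P - 2) P_gt0.
move: (_ %/ _) (_ %% _) => q t lt_t def_m.
exists q, (P - t.+1); split; [lia | nia | | ].
  by rewrite leqNgt; apply/negP=> lt_q; nia.
by move=> def_q; subst q; nia.
Qed.

(** If all genera from [m] on occur, the genus increment is 1, and a single gap
    below [m] shows that no smaller start is possible. *)
Lemma stable_upper_genus_of_gap (gT : finGroupType) (G : {group gT}) (m : nat) :
    0 < m -> (forall g, m <= g -> genus_spectrum G g) -> ~ genus_spectrum G m.-1 ->
  is_stable_upper_genus G m.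
Proof.
move=> m_gt0 stableG gapG; exists 1.
  split=> // [g _|]; first by rewrite !modn1.
  exists (iota 0 m) => g _ _; rewrite mem_iota /= -leqNgt; exact: stableG.
split=> [|g [_ stable_g]].
  by split=> [|k]; apply: stableG; rewrite ?leq_addr.
rewrite leqNgt; apply/negP=> lt_gm; apply: gapG.
have -> : m.-1 = g + 1 * (m.-1 - g) by lia.
exact: stable_g.
Qed.

Section Existence.

Variables (gT : finGroupType) (G : {group gT}) (e : nat) (y x : gT).
Variables (M N : {group gT}).
Hypothesis e_ge5 : 5 <= e.

(** One element of each class if [s] is odd, two reflections of each class if [s]
    is even: in both cases the contributions [2 ^ e.-1] of the reflections add up
    to a multiple of [2 ^ e], and the residue is left to the Frattini subgroup. *)
Lemma dihedral_stable g : rotation_frame G e 1 1 y x M N ->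
  (e - 3) * 2 ^ e + 4 <= g -> genus_spectrum G g.
Proof.
move=> frameG le_g.
have g_ge2 : 2 <= g by apply: leq_trans le_g; rewrite !addnS.
have [||q [s [lt_s RH le_eq eq_e]]] := @genus_normal_form e 3 g isT.
- exact: leq_trans e_ge5.
- by rewrite -addnS.
have e_gt1 : 1 < e by apply: leq_trans e_ge5.
have defP : 2 ^ e = 2 * 2 ^ (e - 1).
  by rewrite -expnS subn1 prednK // (ltnW e_gt1).
have [j def_e] : exists j, e = j.+1 by exists e.-1; rewrite prednK // (ltnW e_gt1).
have defs := odd_double_half s.
have slack : weight e.-1 s./2 + 2 <= q.
  apply: (@weight_slack _ e e.-1) => //; first by lia.
    by rewrite -subn1; lia.
  by move=> /eq_e; rewrite -subn1; lia.
case: (boolP (odd s)) defs => odd_s /= defs.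
  by apply: (@genus_sphere _ _ _ _ _ _ _ _ _ frameG q s 1 1 1 s./2 1) => //; lia.
by apply: (@genus_sphere _ _ _ _ _ _ _ _ _ frameG q s 0 2 2 s./2 2) => //; lia.
Qed.

(** For odd [s] one element of each class, for [s] divisible by 4 two elements of
    order 4 in each class outside [<[y]>]. For [s] congruent to 2 modulo 4 a sphere
    may need more branch points than there is room for, and a torus is used. *)
Lemma quaternion_stable g : rotation_frame G e 2 2 y x M N -> (y ^ x = y^-1)%g ->
  (e - 3) * 2 ^ e + 2 ^ e.-1 + 3 <= g -> genus_spectrum G g.
Proof.
move=> frameG conj_y le_g.
have g_ge2 : 2 <= g by apply: leq_trans le_g; rewrite !addnS.
have [|||q [s [lt_s RH le_eq eq_e]]] := @genus_normal_form e (2 ^ e.-1 + 2) g.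
- by rewrite addnS.
- exact: leq_trans e_ge5.
- by rewrite addnA -addnS.
have e_gt2 : 2 < e by apply: leq_trans e_ge5.
have e_gt1 := ltnW e_gt2.
have [j def_e] : exists j, e = j.+3 by exists (e - 3); rewrite -addn3 subnK.
have [defe2 defe1 defe3] : [/\ e - 2 = j.+1, e.-1 = j.+2 & e.-2 = j.+1].
  by rewrite def_e !subSS subn0.
have R_gt1 : 1 < 2 ^ j.+1 by rewrite (ltn_exp2l 0).
have defs := odd_double_half s; have defh := odd_double_half s./2.
have def2e : 2 ^ e = 4 * 2 ^ j.+1 by rewrite def_e [2 ^ j.+3]expnS expnS mulnA.
have def2e1 : 2 ^ e.-1 = 2 * 2 ^ j.+1 by rewrite defe1 expnS.
have sphere := @genus_sphere _ _ _ _ _ _ _ _ _ frameG q s.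
rewrite defe2 defe1 in sphere.
have slack d S : j.+1 <= d -> S < 2 ^ j.+1 -> (q = e -> S.+1 < 2 ^ j.+1) ->
    weight d S + 3 <= q.
  by move=> le_d; apply: (@weight_slack d e j.+1 3) => //; rewrite def_e addn3.
have weightR : weight j.+2 (2 ^ j.+1) = 1 by apply: weight_exp.
rewrite def2e1 def2e in lt_s eq_e.
case odd_s: (odd s) defs => /= defs.
  (* The two elements of order 4 contribute 2 ^ e.-1 together: a leading digit
     of s is replaced by them, and otherwise an involution completes 2 ^ e. *)
  have [lt_h | le_h] := ltnP s./2 (2 ^ j.+1).
    have lew : weight j.+2 s./2 + 3 <= q.
      by apply: slack => // /eq_e; clear -defs R_gt1; lia.
    apply: (sphere 1 1 1 (s./2 + 2 ^ j.+1) 1 g) => //.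
      by rewrite def2e; clear -defs; lia.
    by have := weightD j.+2 s./2 (2 ^ j.+1); clear -lew weightR; lia.
  have lew : weight j.+2 (s./2 - 2 ^ j.+1) + 3 <= q.
    apply: slack => //; first by clear -defs lt_s; lia.
    by move=> /eq_e; clear -defs le_h; lia.
  apply: (sphere 1 1 1 (s./2 - 2 ^ j.+1) 0 g) => //.
    by clear -defs le_h; lia.
  by clear -lew; lia.
have lt_f : s./2./2 < 2 ^ j.+1 by clear -lt_s; lia.
have lew : weight j.+1 s./2./2 + 3 <= q.
  by apply: slack => // /eq_e; clear -R_gt1; lia.
case odd_h: (odd s./2) defh => /= defh.
  apply: (genus_torus frameG (q := q) (s := s) (S := s./2./2) (c := 0)) => //.
    by clear -defs defh; lia.
  by rewrite defe3; clear -lew; lia.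
apply: (sphere 0 2 2 s./2 1 g) => //.
  by rewrite def2e; clear -defs; lia.
have -> : weight j.+2 s./2 = weight j.+1 s./2./2 by rewrite /= odd_h.
by clear -lew; lia.
Qed.

(** For odd [s] one element of each class, for [s] divisible by 4 two elements in
    each class outside [<[y]>], and otherwise two rotations and two involutions
    outside [<[y]>]. In each case the Frattini elements supply the rest of [s], or
    of [s] plus a multiple of [2 ^ e] when [s] is too small. *)
Lemma semidihedral_stable g : rotation_frame G e 1 2 y x M N ->
  (e - 3) * 2 ^ e + 2 ^ (e - 2) + 3 <= g -> genus_spectrum G g.
Proof.
move=> frameG le_g.
have g_ge2 : 2 <= g by apply: leq_trans le_g; rewrite !addnS.
have [|||q [s [lt_s RH le_eq eq_e]]] := @genus_normal_form e (2 ^ (e - 2) + 2) g.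
- by rewrite addnS.
- exact: leq_trans e_ge5.
- by rewrite addnA -addnS.
have [j def_e] : exists j, e = j.+4.
  by exists (e - 4); rewrite -addn4 subnK // ltnW.
have e_gt1 : 1 < e by rewrite def_e.
have [defe defe2 defe1] : [/\ e - 1 = j.+3, e - 2 = j.+2 & e.-1 = j.+3].
  by rewrite def_e !subSS subn0.
have R_gt1 : 1 < 2 ^ j.+1 by rewrite (ltn_exp2l 0).
have defs := odd_double_half s; have defh := odd_double_half s./2.
have def2j2 : 2 ^ j.+2 = 2 * 2 ^ j.+1 by rewrite expnS.
have def2j3 : 2 ^ j.+3 = 4 * 2 ^ j.+1 by rewrite 2!expnS mulnA.
have def2e : 2 ^ e = 8 * 2 ^ j.+1 by rewrite def_e 3!expnS !mulnA.
have sphere := @genus_sphere _ _ _ _ _ _ _ _ _ frameG q s.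
rewrite defe defe2 defe1 def2j2 def2j3 in sphere.
have slack d i j' S : j' <= d -> j' + i = e.+1 -> S < 2 ^ j' ->
    (q = e -> S.+1 < 2 ^ j') -> weight d S + i <= q.
  by move=> *; apply: (@weight_slack d e j' i).
rewrite defe2 def2j2 def2e in lt_s eq_e.
case odd_s: (odd s) defs => /= defs.
  (* The elements outside the rotations contribute 6 * 2 ^ j.+1. *)
  have [lt_s6 | le_s6] := ltnP s (6 * 2 ^ j.+1).
    have lew : weight j.+3 (s./2 + 2 ^ j.+1) + 2 <= q.
      apply: slack (leqnn _) _ _ _; first by rewrite def_e addn2.
        by rewrite def2j3; clear -defs lt_s6; lia.
      by rewrite def2j3 => /eq_e; clear -defs; lia.
    apply: (sphere 1 1 1 (s./2 + 2 ^ j.+1) 1 g) => //.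
      by rewrite def2e; clear -defs; lia.
    by clear -lew; lia.
  have lew : weight j.+3 (s./2 - 3 * 2 ^ j.+1) + 3 <= q.
    apply: (slack _ _ j.+2) => //; first by rewrite def_e addn3.
      by rewrite def2j2; clear -defs lt_s; lia.
    by move=> /eq_e; clear -le_s6; lia.
  apply: (sphere 1 1 1 (s./2 - 3 * 2 ^ j.+1) 0 g) => //.
    by clear -defs le_s6; lia.
  by clear -lew; lia.
case odd_h: (odd s./2) defh => /= defh.
  have lew : weight j.+2 s./2./2 + 3 <= q.
    apply: slack (leqnn _) _ _ _; first by rewrite def_e addn3.
      by rewrite def2j2; clear -defs defh lt_s; lia.
    by rewrite def2j2 => /eq_e; clear -defs defh R_gt1; lia.
  apply: (sphere 2 2 0 s./2./2.*2 1 g) => //.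
    by rewrite def2e; clear -defs defh; lia.
  have -> : weight j.+3 s./2./2.*2 = weight j.+2 s./2./2.
    by rewrite [LHS]/= odd_double doubleK.
  by clear -lew; lia.
(* Here they contribute 12 * 2 ^ j.+1, which is 4 * 2 ^ j.+1 modulo 2 ^ e. *)
have [lt_s4 | le_s4] := ltnP s (4 * 2 ^ j.+1).
  have lew : weight j.+3 (s./2 + 2 * 2 ^ j.+1) + 2 <= q.
    apply: slack (leqnn _) _ _ _; first by rewrite def_e addn2.
      by rewrite def2j3; clear -defs lt_s4; lia.
    by rewrite def2j3 => _; clear -defs defh lt_s4; lia.
  apply: (sphere 0 2 2 (s./2 + 2 * 2 ^ j.+1) 2 g) => //.
    by rewrite def2e; clear -defs; lia.
  by clear -lew; lia.
have lew : weight j.+3 (s./2 - 2 * 2 ^ j.+1) + 3 <= q.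
  apply: (slack _ _ j.+2) => //; first by rewrite def_e addn3.
    by rewrite def2j2; clear -defs lt_s; lia.
  by rewrite def2j2 => /eq_e; clear -defs R_gt1; lia.
apply: (sphere 0 2 2 (s./2 - 2 * 2 ^ j.+1) 1 g) => //.
  by rewrite def2e; clear -defs le_s4; lia.
by clear -lew; lia.
Qed.

End Existence.

(** * The largest gap *)

Section Bounds.

Variables (gT : finGroupType) (G : {group gT}) (e : nat) (y x : gT).
Variables (M N : {group gT}).
Hypothesis e_ge5 : 5 <= e.

Lemma weight_signature (k l alpha beta gamma n S : nat) :
    0 < k <= e -> 0 < l <= e -> weight e.-1 S <= n ->
  weight e (alpha + beta * 2 ^ (e - k) + gamma * 2 ^ (e - l) + 2 * S)
    <= alpha + beta + gamma + n.
Proof.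
move=> k_e l_e wS; have e_gt0 : 0 < e by apply: leq_trans e_ge5.
have w1 : weight e alpha <= alpha.
  have := weight_muln e alpha 1; rewrite muln1.
  by rewrite -[X in _ * weight e X](expn0 2) weight_exp // muln1.
have wk i m : 0 < i <= e -> weight e (m * 2 ^ (e - i)) <= m.
  move=> i_e; apply: leq_trans (weight_muln _ _ _) _.
  by rewrite weight_exp ?muln1 // ltn_subrL; case/andP: i_e => -> _.
have wS2 : weight e (2 * S) <= n.
  by rewrite -(prednK e_gt0) mul2n weight_double.
rewrite (leq_trans (weightD _ _ _)) // leq_add //.
rewrite (leq_trans (weightD _ _ _)) // leq_add ?wk //.
by rewrite (leq_trans (weightD _ _ _)) // leq_add ?wk.
Qed.

Lemma odd_signature (k l alpha beta gamma S : nat) : k < e -> l < e ->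
  odd (alpha + beta * 2 ^ (e - k) + gamma * 2 ^ (e - l) + 2 * S) = odd alpha.
Proof.
have even_exp m : m < e -> odd (2 ^ (e - m)) = false.
  by move=> lt_m; rewrite oddX orbF subn_eq0 leqNgt lt_m.
move=> lt_ke lt_le; rewrite mul2n !oddD odd_double !oddM !even_exp //.
by rewrite !andbF !addbF.
Qed.

(** Here [T] is the sum of the powers of two attached to [n] branch points. If it
    exceeds [s] by [c * 2 ^ e], its weight is [e.-1 + 2 * c], while the equation
    admits only [e + c - 2 * h] summands; hence [c + 2 * h <= 1]. *)
Lemma tight_decomposition (s T n h : nat) :
    s < 2 ^ e -> weight e s = e.-1 -> weight e T <= n ->
    T + e * 2 ^ e = (2 * h + n) * 2 ^ e + s ->
  h = 0 /\ (T = s /\ n = e \/ T = 2 ^ e + s /\ n = e.+1).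
Proof.
move=> lt_s ws wT defT; have P_gt0 : 0 < 2 ^ e by rewrite expn_gt0.
have le_en : e <= 2 * h + n.
  rewrite leqNgt; apply/negP=> lt_n.
  have : (2 * h + n).+1 * 2 ^ e <= e * 2 ^ e by apply: leq_mul.
  by rewrite mulSn; move: (2 ^ e) lt_s defT => P; clear; lia.
pose c := 2 * h + n - e; have def_n : 2 * h + n = e + c by rewrite subnKC.
have {}defT : T = c * 2 ^ e + s.
  by move: defT; rewrite def_n mulnDl; clear; lia.
have := weight_split 0 c lt_s; rewrite addn0 -defT ws /= => wTE.
have c_le : c + 2 * h <= 1 by clear -wTE wT def_n e_ge5; lia.
split; first by clear -c_le; lia.
case: (posnP c) => [c0 | c_gt0]; [left | right]; split.
- by rewrite defT c0.
- by clear -def_n c_le c0; lia.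
- have c1 : c = 1 by clear -c_le c_gt0; lia.
  by rewrite defT c1 mul1n.
- by clear -def_n c_le c_gt0; lia.
Qed.

(** The critical residue is [2 ^ e - 2]. As it is even, so are the three counts.
    Two or more elements outside [<[y]>] exceed it, so [T] is larger by [2 ^ e]
    and there are just two of them, one class, and at least two rotations. What
    then remains is [2 ^ e - 4], with one summand fewer than its weight. *)
Lemma dihedral_gap : rotation_frame G e 1 1 y x M N ->
  ~ genus_spectrum G ((e - 3) * 2 ^ e + 3).
Proof.
move=> frameG /(genus_signature frameG)[_ [h [al [be [ga [n [S [wS RH sphere]]]]]]]].
have e_gt2 : 2 < e by apply: leq_trans e_ge5.
have e_gt0 : 0 < e by apply: leq_trans e_ge5.
have le_1e : 0 < 1 <= e by [].
have wT := weight_signature al be ga le_1e le_1e wS.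
have wrest := weight_signature (al - 2) 0 0 le_1e le_1e wS.
have [j def_e] : exists j, e = j.+3.
  by case: (e) e_ge5 => [|[|[|j]]] // _; exists j.
have defP : 2 ^ (e - 1) = 4 * 2 ^ j by rewrite def_e subSS subn0 2!expnS mulnA.
have def2e : 2 ^ e = 8 * 2 ^ j by rewrite def_e 3!expnS !mulnA.
have Q_gt0 : 0 < 2 ^ j by rewrite expn_gt0.
have ws : weight e (2 ^ e - 2) = e.-1.
  have -> : 2 ^ e - 2 = (2 ^ j.+2).-1.*2.
    by rewrite def2e 2!expnS; clear -Q_gt0; lia.
  by rewrite def_e weight_double weight_ones.
have ws' : weight e (2 ^ e - 4) = e - 2.
  have -> : 2 ^ e - 4 = (2 ^ j.+1).-1.*2.*2.
    by rewrite def2e expnS; clear -Q_gt0; lia.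
  by rewrite def_e !weight_double weight_ones !subSS subn0.
have lt_s : 2 ^ e - 2 < 2 ^ e by rewrite def2e; clear -Q_gt0; lia.
have {RH} RH : al + be * 2 ^ (e - 1) + ga * 2 ^ (e - 1) + 2 * S + e * 2 ^ e
    = (2 * h + (al + be + ga + n)) * 2 ^ e + (2 ^ e - 2).
  have defe : e * 2 ^ e = (e - 3) * 2 ^ e + 3 * 2 ^ e.
    by rewrite -mulnDl subnK // def_e.
  move: RH; rewrite expnS defe.
  move: (al + _ + _ + _) (al + be + ga + n) => T m.
  rewrite def2e; move: (2 ^ j) Q_gt0 => R R_gt0.
  by clear -R_gt0; lia.
have [h0 cases] := tight_decomposition lt_s ws wT RH.
have [odd_a odd_b /and3P[ab_gt0 ag_gt0 bg_gt0]] := sphere h0.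
rewrite !mul0n !addn0 in wrest; rewrite defP in cases.
have oddT := odd_signature al be ga S (ltnW e_gt2) (ltnW e_gt2).
have even_a : odd al = false.
  by case: cases => -[defT _]; rewrite -oddT defP defT def2e; clear -Q_gt0; lia.
have even_g : odd ga = false by rewrite -odd_a.
rewrite even_g in odd_b.
have bg_ge2 : 2 <= be + ga by clear -bg_gt0 odd_b even_g; lia.
have : 2 * 2 ^ j <= (be + ga) * 2 ^ j by rewrite leq_mul2r bg_ge2 orbT.
case: cases => -[defT defn]; rewrite def2e in defT.
  by clear -defT Q_gt0; lia.
have bg_lt4 : be + ga < 4.
  rewrite ltnNge; apply/negP=> bg_ge4.
  have : 4 * 2 ^ j <= (be + ga) * 2 ^ j by rewrite leq_mul2r bg_ge4 orbT.
  by clear -defT Q_gt0; lia.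
have bg2 : be + ga = 2 by clear -bg_lt4 bg_gt0 odd_b even_g; lia.
have al_ge2 : 2 <= al by clear -bg2 ab_gt0 ag_gt0 even_a odd_b even_g; lia.
move=> _; have defbg : (be + ga) * 2 ^ j = 2 * 2 ^ j by rewrite bg2.
have defR : al - 2 + 2 * S = 2 ^ e - 4.
  by rewrite def2e; clear -defT defbg al_ge2; lia.
by rewrite defR ws' in wrest; clear -wrest bg2 defn al_ge2 e_gt2; lia.
Qed.

(** The critical residue falls short by 1 of the contribution of one element of
    each class outside [<[y]>]. It is odd, so both classes occur and [T] exceeds
    it by [2 ^ e]; removing these two elements leaves [2 ^ e - 1] as a sum of
    [e.-1] powers of two, one summand too few. *)
Lemma odd_gap (k l s g : nat) : rotation_frame G e k l y x M N ->
    k < e -> l < e ->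
    s.+1 = 2 ^ (e - k) + 2 ^ (e - l) -> s < 2 ^ e -> odd s -> weight e s = e.-1 ->
    g + s + 2 ^ e.+1 = 1 + e * 2 ^ e ->
  ~ genus_spectrum G g.
Proof.
move=> frameG lt_ke lt_le def_s lt_s odd_s ws def_g.
case/(genus_signature frameG) => _ [h [al [be [ga [n [S [wS RH sphere]]]]]]].
have [k_e l_e] := frame_exps frameG.
have wT := weight_signature al be ga k_e l_e wS.
have e_gt0 : 0 < e by apply: leq_trans e_ge5.
have wrest := weight_signature al be.-1 ga.-1 k_e l_e wS.
have {RH} RH : al + be * 2 ^ (e - k) + ga * 2 ^ (e - l) + 2 * S + e * 2 ^ e
    = (2 * h + (al + be + ga + n)) * 2 ^ e + s.
  move: RH def_g; rewrite expnS.
  move: (al + _ + _ + _) (al + be + ga + n) => T m.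
  by move: (2 ^ e) => P; clear; lia.
have [h0 cases] := tight_decomposition lt_s ws wT RH.
have [odd_a odd_b _] := sphere h0.
have odd_al : odd al.
  rewrite -(odd_signature al be ga S lt_ke lt_le).
  by case: cases => -[-> _] //; rewrite oddD oddX odd_s addbT orbF -lt0n.
have [be_gt0 ga_gt0] : 0 < be /\ 0 < ga.
  by split; apply: odd_gt0; rewrite ?odd_b -odd_a.
rewrite -(prednK be_gt0) -(prednK ga_gt0) !mulSn in cases.
move: (be.-1 * _) (ga.-1 * _) wrest cases => B C wrest.
case=> -[defT defn]; first by clear -defT def_s; lia.
have defR : al + B + C + 2 * S = (2 ^ e).-1.
  by clear -defT def_s; lia.
by rewrite defR weight_ones in wrest; clear -wrest defn e_gt0; lia.
Qed.

End Bounds.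

(** * Minimum genus and conclusion *)

Section Minimum.

Variables (gT : finGroupType) (G : {group gT}) (e k l : nat) (y x : gT).
Variables (M N : {group gT}).
Hypothesis e_ge5 : 5 <= e.
Hypothesis frameG : rotation_frame G e k l y x M N.

(** A sphere with one branch point of each class, and possibly ([b]) one more of
    order 2 at the central involution. *)
Lemma genus_triangle (g : nat) (b : bool) : 2 <= g ->
    g + 2 ^ (e - k) + 2 ^ (e - l) = 2 ^ e + b * 2 ^ e.-1 ->
  genus_spectrum G g.
Proof.
move=> g_ge2 def_g; have e_gt1 : 1 < e by apply: leq_trans e_ge5.
have [j def_e] : exists j, e = j.+2.
  by case: (e) e_ge5 => [|[|j]] // _; exists j.
have [defe1 def2e1] : e.-1 = j.+1 /\ 2 ^ e = 4 * 2 ^ j.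
  by rewrite def_e 2!expnS mulnA.
apply: (@genus_sphere _ _ _ _ _ _ _ _ _ frameG (3 + b)
  (1 + 2 ^ (e - k) + 2 ^ (e - l) + b * 2 ^ e.-1) 1 1 1 (b * 2 ^ j) 0 g) => //.
- move: def_g; rewrite mulnDl [2 ^ e.+1]expnS def2e1 defe1 expnS.
  by move: (2 ^ j) (2 ^ _) (2 ^ _) => R B C; clear; case: b; lia.
- by rewrite defe1 expnS; clear; case: b; lia.
- rewrite defe1 addn0.
  by case: (b); rewrite ?[true * _]mul1n ?[false * _]mul0n ?weight_exp ?weight0.
Qed.

(** Every branch point, and every handle beyond the first, contributes at least
    [2 ^ e.-1] to [g.-1], so only the fewest branch points matter. On a sphere
    these are one in each class, of genus [2 ^ e - 2 ^ (e - k) - 2 ^ (e - l)], or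
    two in each of two classes; a total of genus 0 or 1 requires a further
    branch point. *)
Lemma genus_lower_bound (mu g : nat) : genus_spectrum G g ->
    mu <= 2 ^ e.-1 ->
    (2 ^ (e - k) + 2 ^ (e - l) < 2 ^ e -> mu + 2 ^ (e - k) + 2 ^ (e - l) <= 2 ^ e) ->
  mu <= g.
Proof.
case/(genus_signature frameG)=> g_ge2 [h [al [be [ga [n [S [wS RH sphere]]]]]]].
have [/andP[k_gt0 le_ke] /andP[l_gt0 le_le]] := frame_exps frameG.
have [j def_e] : exists j, e = j.+2.
  by case: (e) e_ge5 => [|[|j]] // _; exists j.
have [defe1 def2e] : e.-1 = j.+1 /\ 2 ^ e = 4 * 2 ^ j.
  by rewrite def_e 2!expnS mulnA.
have le_S : S <= n * 2 ^ j.
  have := leq_weight_exp e.-1 S; rewrite defe1 in wS *; move/leq_trans; apply.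
  by rewrite leq_mul2r wS orbT.
have leB i : 0 < i -> 2 ^ (e - i) <= 2 * 2 ^ j.
  by move=> i_gt0; rewrite -expnS leq_exp2l // def_e; clear -i_gt0; lia.
have R_gt0 : 0 < 2 ^ j by rewrite expn_gt0.
have [leBk leCl] := (leB k k_gt0, leB l l_gt0).
move: RH; rewrite [2 ^ e.+1]expnS def2e defe1 expnS {defe1 def2e leB def_e}.
move: (2 ^ j) (2 ^ (e - k)) (2 ^ (e - l)) => R B C in leBk leCl R_gt0 le_S *.
move=> RH le_mu le_muBC.
(* No branch point contributes less than 2 * R, that is 2 ^ e.-1. *)
pose quantum v := v = 0 \/ 2 * R <= v.
have quantumM i v : 2 * R <= v -> quantum (i * v).
  move=> le_v; case: i => [|i]; first by left.
  by right; rewrite mulSn (leq_trans le_v) ?leq_addr.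
have qn : quantum (n * (4 * R) - 2 * S).
  case: (n) le_S => [|n'] le_S; first by left; clear -le_S; lia.
  by right; move: le_S; rewrite !mulSn; clear; nia.
have {RH} RH : g + 8 * R = 1 + 8 * (h * R) + (al * (4 * R - 1) + be * (4 * R - B)
    + ga * (4 * R - C) + (n * (4 * R) - 2 * S)).
  have := leq_mul (leqnn be) leBk; have := leq_mul (leqnn ga) leCl.
  move: RH; rewrite !mulnBr; clear -le_S R_gt0; nia.
have /quantumM qa : 2 * R <= 4 * R - 1 by clear -R_gt0; lia.
have /quantumM qb : 2 * R <= 4 * R - B by clear -leBk; lia.
have /quantumM qc : 2 * R <= 4 * R - C by clear -leCl; lia.
have [h0 | h_gt0] := posnP h.
  have [odd_a odd_b /and3P[ab_gt0 ag_gt0 bg_gt0]] := sphere h0.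
  rewrite h0 mul0n in RH; case odd_c: (odd ga) odd_a odd_b => odd_a odd_b.
    have [al' def_a] : exists al', al = al'.+1 by exists al.-1; clear -odd_a; lia.
    have [be' def_b] : exists be', be = be'.+1 by exists be.-1; clear -odd_b; lia.
    have [ga' def_c] : exists ga', ga = ga'.+1 by exists ga.-1; clear -odd_c; lia.
    rewrite def_a def_b def_c !mulSn in RH.
    have := qa al'; have := qb be'; have := qc ga'.
    move: (al' * _) (be' * _) (ga' * _) (n * _ - _) RH qn => a b c d RH qn.
    by rewrite /quantum in qn *; clear -RH qn leBk leCl R_gt0 g_ge2 le_mu le_muBC; lia.
  have ge2 m : odd m = false -> 0 < m -> exists m', m = m'.+2.
    by case: m => [|[|m]] // _ _; exists m.
  have [[a0 c0] | [b0 c0] | [a0 b0]] : [\/ 0 < al /\ 0 < ga, 0 < be /\ 0 < ga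
                                        | 0 < al /\ 0 < be].
  - case: (posnP al) => a0; first by constructor 2; clear -a0 ab_gt0 ag_gt0; lia.
    by case: (posnP be) => b0; [constructor 1 | constructor 3];
      clear -a0 b0 bg_gt0; lia.
  - have [[al' def_a] [ga' def_c]] := (ge2 _ odd_a a0, ge2 _ odd_c c0).
    rewrite def_a def_c !mulSn in RH.
    have := qa al'; have := qb be; have := qc ga'.
    move: (al' * _) (be * _) (ga' * _) (n * _ - _) RH qn => a b c d RH qn.
    by rewrite /quantum in qn *; clear -RH qn leBk leCl R_gt0 g_ge2 le_mu le_muBC; lia.
  - have [[be' def_b] [ga' def_c]] := (ge2 _ odd_b b0, ge2 _ odd_c c0).
    rewrite def_b def_c !mulSn in RH.
    have := qa al; have := qb be'; have := qc ga'.
    move: (al * _) (be' * _) (ga' * _) (n * _ - _) RH qn => a b c d RH qn.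
    by rewrite /quantum in qn *; clear -RH qn leBk leCl R_gt0 g_ge2 le_mu le_muBC; lia.
  - have [[al' def_a] [be' def_b]] := (ge2 _ odd_a a0, ge2 _ odd_b b0).
    rewrite def_a def_b !mulSn in RH.
    have := qa al'; have := qb be'; have := qc ga.
    move: (al' * _) (be' * _) (ga * _) (n * _ - _) RH qn => a b c d RH qn.
    by rewrite /quantum in qn *; clear -RH qn leBk leCl R_gt0 g_ge2 le_mu le_muBC; lia.
have := qa al; have := qb be; have := qc ga; rewrite /quantum in qn *.
have qh : quantum (h.-1 * (2 * R)) by apply: quantumM.
have defh : h * R = R + h.-1 * R by rewrite -mulSn prednK.
move: (al * _) (be * _) (ga * _) (n * _ - _) RH qn => a b c d RH qn.
by rewrite /quantum mulnCA in qh; clear -RH qn qh defh g_ge2 le_mu; lia.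
Qed.

End Minimum.

Section Main.

Variables (gT : finGroupType) (G : {group gT}) (e : nat).
Hypotheses (e_ge5 : 5 <= e) (oG : #|G| = 2 ^ e.+1).

Lemma dihedral_genera : is_dihedral e G ->
  is_minimum_genus G (2 ^ e.-1) /\ is_stable_upper_genus G ((e - 3) * 2 ^ e + 4).
Proof.
case/(dihedral_frame e_ge5 oG)=> y [x [M [N frameG]]].
have [j def_e] : exists j, e = j.+2 by case: (e) e_ge5 => [|[|j]] // _; exists j.
have R_gt0 : 0 < 2 ^ j by rewrite expn_gt0.
have [def2e1 def2e2 def2e] : [/\ 2 ^ (e - 1) = 2 * 2 ^ j, 2 ^ e.-1 = 2 * 2 ^ j
                               & 2 ^ e = 4 * 2 ^ j].
  by rewrite def_e subn1 /= !expnS; split; lia.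
split; [split=> [|g spG] | ].
- apply: (genus_triangle e_ge5 frameG (b := true)); rewrite ?def2e1 ?def2e ?def2e2;
    by clear -R_gt0; lia.
- apply: (genus_lower_bound e_ge5 frameG spG) => //.
  by rewrite def2e1 def2e2 def2e; clear; lia.
apply: stable_upper_genus_of_gap => [|g le_g|]; first by rewrite addnS.
  exact: dihedral_stable frameG le_g.
by rewrite addnS; apply: dihedral_gap frameG.
Qed.

Lemma quaternion_genera : is_quaternion e G ->
  is_minimum_genus G (2 ^ e.-1) /\
  is_stable_upper_genus G ((e - 3) * 2 ^ e + 2 ^ e.-1 + 3).
Proof.
case/(quaternion_frame e_ge5 oG)=> y [x [M [N [frameG conj_y]]]].
have e_gt2 : 2 < e by apply: leq_trans e_ge5.
have [j def_e] : exists j, e = j.+3 by case: (e) e_gt2 => [|[|[|j]]] // _; exists j.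
have R_gt0 : 0 < 2 ^ j by rewrite expn_gt0.
have [def2e1 def2e2 def2e] : [/\ 2 ^ (e - 2) = 2 * 2 ^ j, 2 ^ e.-1 = 4 * 2 ^ j
                               & 2 ^ e = 8 * 2 ^ j].
  by rewrite def_e !subSS subn0 /= !expnS; split; lia.
split; [split=> [|g spG] | ].
- apply: (genus_triangle e_ge5 frameG (b := false)); rewrite ?def2e1 ?def2e ?def2e2;
    by clear -R_gt0; lia.
- apply: (genus_lower_bound e_ge5 frameG spG) => //.
  by rewrite def2e1 def2e2 def2e; clear; lia.
apply: stable_upper_genus_of_gap => [|g le_g|]; first by rewrite addnS.
  exact: quaternion_stable frameG conj_y le_g.
rewrite addnS; apply: (odd_gap e_ge5 frameG (s := (2 ^ e.-1).-1)) => //.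
- by rewrite def2e1 def2e2; clear -R_gt0; lia.
- by rewrite def2e def2e2; clear -R_gt0; lia.
- by rewrite def2e2; clear -R_gt0; lia.
- rewrite (@weight_small _ e.-1) ?leq_pred ?weight_ones //.
  by rewrite def2e2; clear -R_gt0; lia.
have -> : e * 2 ^ e = (e - 3) * 2 ^ e + 3 * 2 ^ e by rewrite -mulnDl subnK.
by rewrite expnS def2e2 def2e; move: (e - 3) => m; clear -R_gt0; lia.
Qed.

Lemma semidihedral_genera : is_semidihedral e G ->
  is_minimum_genus G (2 ^ (e - 2)) /\
  is_stable_upper_genus G ((e - 3) * 2 ^ e + 2 ^ (e - 2) + 3).
Proof.
case/(semidihedral_frame e_ge5 oG)=> y [x [M [N frameG]]].
have e_gt2 : 2 < e by apply: leq_trans e_ge5.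
have [j def_e] : exists j, e = j.+3 by case: (e) e_gt2 => [|[|[|j]]] // _; exists j.
have R_gt0 : 0 < 2 ^ j by rewrite expn_gt0.
have [def2e1 def2e2 def2e3 def2e] : [/\ 2 ^ (e - 1) = 4 * 2 ^ j,
    2 ^ (e - 2) = 2 * 2 ^ j, 2 ^ e.-1 = 4 * 2 ^ j & 2 ^ e = 8 * 2 ^ j].
  by rewrite def_e !subSS subn0 /= !expnS; split; lia.
split; [split=> [|g spG] | ].
- apply: (genus_triangle e_ge5 frameG (b := false)); rewrite ?def2e1 ?def2e ?def2e2;
    by clear -R_gt0; lia.
- apply: (genus_lower_bound e_ge5 frameG spG); rewrite ?def2e1 ?def2e2 ?def2e3 ?def2e;
  by clear; lia.
apply: stable_upper_genus_of_gap => [|g le_g|]; first by rewrite addnS.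
  exact: semidihedral_stable frameG le_g.
rewrite addnS; apply: (odd_gap e_ge5 frameG (s := 2 * 2 ^ j.+1 + (2 ^ j.+1).-1)) => //.
- by rewrite def_e.
- by rewrite def2e1 def2e2 [2 ^ j.+1]expnS; clear -R_gt0; lia.
- by rewrite def2e [2 ^ j.+1]expnS; clear -R_gt0; lia.
- by rewrite [2 ^ j.+1]expnS; clear -R_gt0; lia.
- have -> : e = j.+1 + 2 by rewrite def_e !addnS addn0.
  by rewrite weight_split ?ltn_predL ?expn_gt0 ?weight_ones // !addnS addn0.
have -> : e * 2 ^ e = (e - 3) * 2 ^ e + 3 * 2 ^ e by rewrite -mulnDl subnK.
rewrite [2 ^ e.+1]expnS def2e2 def2e [2 ^ j.+1]expnS.
by move: (e - 3) => m; clear -R_gt0; lia.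
Qed.

End Main.

Theorem theorem3p4 (e : nat) (gT : finGroupType) (G : {group gT})
    (he : 5 <= e) (hG : maximal_class 2 G) (oG : #|G| = 2 ^ e.+1) :
  [/\ is_dihedral e G ->
        is_minimum_genus G (2 ^ e.-1) /\
        is_stable_upper_genus G ((e - 3) * 2 ^ e + 4),
      is_quaternion e G ->
        is_minimum_genus G (2 ^ e.-1) /\
        is_stable_upper_genus G ((e - 3) * 2 ^ e + 2 ^ e.-1 + 3)
    & is_semidihedral e G ->
        is_minimum_genus G (2 ^ (e - 2)) /\
        is_stable_upper_genus G ((e - 3) * 2 ^ e + 2 ^ (e - 2) + 3)].
Proof.
split; first exact: dihedral_genera.
  exact: quaternion_genera.
exact: semidihedral_genera.
Qed.
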